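(* Fix an integer $\Lambda\ge2$ and let $G=(V,E)$ be a loopless series-parallel graph of maxmaxflow at most $\Lambda$. Let $\rho^\star_\Lambda$ be the unique solution in $(0,1)$ of $(1+\rho)^\Lambda=2(1+\rho^2)^{\Lambda-1}$ when $\Lambda\ge3$, and $\rho^\star_2=1$. Let $q\in\mathbb C$ satisfy $|q-1|\ge1/\rho^\star_\Lambda$ (strict inequality $>$ when $\Lambda=2$), put $\rho=1/|q-1|$ and $X=\big(2/(1+\rho)\big)^{1/(\Lambda-1)}$, and let the edge weights $\mathbf v=(v_e)_{e\in E}$ satisfy, for each $e$, either $v_e$ is real with $-1\le v_e\le0$, or $q+v_e\ne0$ and $\left|\dfrac{v_e}{q+v_e}\right|\le\rho\,\dfrac{X-1}{1-\rho X}$ (strict inequality in this second condition when $\Lambda=2$). Then $Z_G(q,\mathbf v)\neq0$.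
   Context: Multivariate Tutte polynomial of $G=(V,E)$: $Z_G(q,\mathbf v)=\sum_{A\subseteq E}q^{k(A)}\prod_{e\in A}v_e$, $k(A)$ = number of connected components of $(V,A)$. $\lambda_G(x,y)$ = maximum number of pairwise edge-disjoint $x$–$y$ paths; maxmaxflow $\Lambda(G)=\max_{x\ne y}\lambda_G(x,y)$ (0 if fewer than two vertices). A loopless graph is series-parallel if it can be obtained from a forest by a finite (possibly empty) sequence of operations, each replacing an edge by two edges in series (subdivision) or by two parallel edges. *)

(* Defs.v *)
From HB Require Import structures.
From mathcomp Require Import all_boot all_order all_algebra.
Set Implicit Arguments. Unset Strict Implicit. Unset Printing Implicit Defensive.
Import Order.TTheory GRing.Theory Num.Theory.

(* A (multi)graph G = (V,E) is given by finite types V, E and an endpoint map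
   ends : E -> V * V (edges are undirected; the orientation of ends e is
   irrelevant). Parallel edges are allowed. *)

Section Graph.
Variables (V E : finType) (ends : E -> V * V).

Definition joins (e : E) (a b : V) : bool :=
  (ends e == (a, b)) || (ends e == (b, a)).

Definition loopless : Prop := forall e, (ends e).1 != (ends e).2.

Fixpoint is_walk (x : V) (vs : seq V) (es : seq E) : bool :=
  match vs, es with
  | [::], [::] => true
  | v :: vs', e :: es' => joins e x v && is_walk v vs' es'
  | _, _ => false
  end.

Definition is_path (x y : V) (p : seq V * seq E) : bool :=
  [&& is_walk x p.1 p.2, last x p.1 == y & uniq (x :: p.1)].

Definition edge_disjoint (p1 p2 : seq V * seq E) : bool :=
  all (fun e => e \notin p2.2) p1.2.

Definition maxmaxflow_le (L : nat) : Prop :=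
  forall x y : V, x != y ->
  forall P : seq (seq V * seq E),
    all (is_path x y) P -> pairwise edge_disjoint P -> size P <= L.

Definition is_cycle (x : V) (vs : seq V) (es : seq E) : bool :=
  [&& es != [::], is_walk x vs es, last x vs == x, uniq vs & uniq es].

Definition forest : Prop := forall x vs es, ~~ is_cycle x vs es.

Definition comp_rel (A : {set E}) : rel V :=
  fun a b => [exists e in A, joins e a b].

Definition ncomp (A : {set E}) : nat := n_comp (comp_rel A) V.

Definition Zpoly (R : comPzRingType) (q : R) (v : E -> R) : R :=
  (\sum_(A : {set E}) q ^+ ncomp A * \prod_(e in A) v e)%R.

End Graph.

Definition subdiv_ends (V E : finType) (ends : E -> V * V) (e0 : E)
  : option E -> option V * option V :=
  fun o => match o with
  | Some e => if e == e0 then (Some (ends e0).1, None)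
              else (Some (ends e).1, Some (ends e).2)
  | None => (None, Some (ends e0).2)
  end.

Definition par_ends (V E : finType) (ends : E -> V * V) (e0 : E)
  : option E -> V * V :=
  fun o => match o with Some e => ends e | None => ends e0 end.

Inductive series_parallel : forall (V E : finType), (E -> V * V) -> Prop :=
| sp_forest (V E : finType) (ends : E -> V * V) :
    forest ends -> series_parallel ends
| sp_series (V E : finType) (ends : E -> V * V) (e0 : E) :
    series_parallel ends -> series_parallel (subdiv_ends ends e0)
| sp_parallel (V E : finType) (ends : E -> V * V) (e0 : E) :
    series_parallel ends -> series_parallel (par_ends ends e0)
| sp_iso (V E V' E' : finType) (ends : E -> V * V) (ends' : E' -> V' * V')
    (fV : V -> V') (fE : E -> E') :
    bijective fV -> bijective fE ->
    (forall e, ends' (fE e) = (fV (ends e).1, fV (ends e).2) \/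
               ends' (fE e) = (fV (ends e).2, fV (ends e).1)) ->
    series_parallel ends -> series_parallel ends'.

(* Main.v *)
(* Put [Q = q - 1], so [rho = 1 / |Q|], and attach to a weight [w] its
   transmissivity [t = w / (q + w)], which is multiplicative in series, while
   [1 + w = (1 + Q t) / (1 - t)] is multiplicative in parallel.  The discs
   [|t| <= r_c], [r_c = rho (X^c - 1) / (1 - rho X^c)], satisfy
   "r_c parallel r_d within r_(c+d)", and [X] is chosen so that
   [r_(L-1) = rho]; the condition on [rho] says exactly [r_1 >= rho^2], so any two
   weights of the disc [r_(L-1)] in series land in the disc [r_1].  A weight in
   [-1, 0] multiplies [1 + w] by a factor in [0, 1], which need not preserve the
   disc [r_c] but preserves [r_(L-1)].
   Reversing the series-parallel construction, each edge stands for a two-terminal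
   piece and carries a capacity [c], the flow through that piece, with its weight in
   the disc [r_c] up to a factor in [0, 1].  When a parallel reduction yields
   capacity [L], the flow bound makes the new edge a bridge, which only contributes
   the nonzero factor [(q + w) / q]. *)
Require Import Defs.
From HB Require Import structures.
From mathcomp Require Import all_boot all_order all_algebra.
From mathcomp Require Import ring.
Import Order.TTheory GRing.Theory Num.Theory.
Local Open Scope ring_scope.
Local Set Implicit Arguments.
Local Unset Strict Implicit.

(** * Walks and their shortening to paths *)

Section Walks.
Variables (V E : finType) (ends : E -> V * V).
Implicit Types (x y z : V) (vs : seq V) (es : seq E).

Lemma joinsC e x y : joins ends e x y = joins ends e y x.
Proof. by rewrite /joins orbC. Qed.

Lemma joins_ends e : joins ends e (ends e).1 (ends e).2.
Proof. by rewrite /joins -surjective_pairing eqxx. Qed.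

Lemma joins_mem e x y z w : joins ends e x y -> joins ends e z w ->
  x \in [:: z; w].
Proof.
by rewrite /joins !inE => /orP[]/eqP-> /orP[]/eqP[? ?]; subst; rewrite eqxx ?orbT.
Qed.

Lemma is_walk_cat x vs1 es1 vs2 es2 :
  is_walk ends x vs1 es1 -> is_walk ends (last x vs1) vs2 es2 ->
  is_walk ends x (vs1 ++ vs2) (es1 ++ es2).
Proof.
elim: vs1 es1 x => [|z vs1 IH] [|e es1] x //= /andP[-> /=].
exact: IH.
Qed.

Lemma is_walk_mem x vs es e y z : is_walk ends x vs es -> e \in es ->
  joins ends e y z -> y \in x :: vs.
Proof.
elim: vs es x => [|w vs IH] [|f es] x //= /andP[fxw wk].
rewrite inE => /predU1P[->|ein] eyz; last by rewrite inE (IH _ _ wk ein eyz) orbT.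
by have:= joins_mem eyz fxw; rewrite !inE => /orP[]->; rewrite ?orbT.
Qed.

Lemma is_walk_uniq x vs es : is_walk ends x vs es -> uniq (x :: vs) -> uniq es.
Proof.
elim: vs es x => [|w vs IH] [|f es] x //= /andP[fxw wk] /andP[xnin un].
rewrite (IH _ _ wk un) andbT; apply: contra xnin => fin.
exact: is_walk_mem wk fin fxw.
Qed.

Lemma is_walk_suffix x y vs es : is_walk ends y vs es -> uniq (y :: vs) ->
  x \in y :: vs -> exists2 p : seq V * seq E,
    is_path ends x (last y vs) p & all (fun e => e \in es) p.2.
Proof.
elim: vs es y => [|z vs IH] [|e es] y //=.
  by rewrite inE => _ _ /eqP->; exists ([::], [::]); rewrite // /is_path /= eqxx.
case/andP=> eyz wk /andP[yn un]; rewrite inE => /predU1P[->|xin].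
  exists (z :: vs, e :: es); last by apply/allP.
  by rewrite /is_path /= eyz wk eqxx; move: yn un => /= -> /=.
have [p pp /allP sub] := IH _ _ wk un xin.
by exists p => //; apply/allP => f /sub fin; rewrite inE fin orbT.
Qed.

(** Loop erasure, from the end of the walk backwards: if the new first vertex already lies on the
    shortened tail, [is_walk_suffix] drops the detour back to it. *)
Lemma walk_shorten x vs es : is_walk ends x vs es ->
  exists2 p : seq V * seq E,
    is_path ends x (last x vs) p & all (fun e => e \in es) p.2.
Proof.
elim: vs es x => [|w vs IH] [|f es] x //= => [_|/andP[fxw wk]].
  by exists ([::], [::]); rewrite // /is_path /= eqxx.
have{IH wk} [[vs' es'] /and3P[/= wk /eqP la un] /allP sub] := IH _ _ wk.
have [xin|xnin] := boolP (x \in w :: vs').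
  have [p] := is_walk_suffix wk un xin; rewrite la => pp /allP sub'.
  by exists p => //; apply/allP => e /sub' /sub ein; rewrite inE ein orbT.
exists (w :: vs', f :: es').
  by rewrite /is_path /= fxw wk la eqxx; move: xnin un => /= -> /=.
rewrite /= mem_head; apply/allP => e /sub ein; rewrite inE.
by apply/orP; right.
Qed.

Lemma connect_walk (A : {set E}) x y : connect (comp_rel ends A) x y ->
  exists vs es, [/\ is_walk ends x vs es, last x vs = y & all (fun e => e \in A) es].
Proof.
case/connectP => p + ->; elim: p x => [|z p IH] x /=.
  by exists [::], [::].
case/andP=> /existsP[e /andP[eA exz]] /IH [vs [es [wk la al]]].
by exists (z :: vs), (e :: es); rewrite /= exz wk la eA al.
Qed.

End Walks.

(** * Edge-disjoint families and flow with capacities *)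

Definition disj (W : Type) (S : eqType) (p1 p2 : W * seq S) : bool :=
  all (fun s => s \notin p2.2) p1.2.

(** Disjointness pulls back along [pi]: an edge shared by two lifted walks would project to an edge
    shared by the originals. *)
Lemma disj_lift (W W' S S' : eqType) (pi : S' -> S)
    (A : pred (W * seq S)) (B : pred (W' * seq S')) :
  (forall p, A p -> exists2 p', B p' & all (fun s => pi s \in p.2) p'.2) ->
  forall P, all A P -> pairwise (@disj W S) P ->
  exists P', [/\ size P' = size P, all B P' & pairwise (@disj W' S') P'].
Proof.
move=> AB P alP dP.
(* The induction has to remember that each member of [P'] projects into some member of [P]. *)
suff [P' [sP alB dP' _]] : exists P', [/\ size P' = size P, all B P',
    pairwise (@disj W' S') P' &
    forall p', p' \in P' -> exists2 p, p \in P & all (fun s => pi s \in p.2) p'.2].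
  by exists P'.
elim: P alP dP => [|p P IH]; first by exists [::].
rewrite pairwise_cons => /= /andP[/AB[p' Bp' sub] alP] /andP[dp dP].
have [P' [sP alB dP' sub']] := IH alP dP.
exists (p' :: P'); split=> /=; rewrite ?sP ?Bp' //.
- rewrite dP' andbT; apply/allP => r' /sub'[r rP subr].
  apply/allP => s sp'; apply/negP => sr'.
  have := allP (allP dp _ rP) _ (allP sub _ sp').
  by rewrite (allP subr _ sr').
- move=> r; rewrite inE => /predU1P[->|/sub'[r0 r0P ?]].
    by exists p; rewrite ?mem_head.
  by exists r0; rewrite ?inE ?r0P ?orbT.
Qed.

(* An edge [e] of capacity [c e] is a bundle of parallel unit edges [(e, i)]
   with [i < c e]. *)
Definition cap_walk (V E : finType) (ends : E -> V * V) (c : E -> nat)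
    (x y : V) (p : seq V * seq (E * nat)) : bool :=
  [&& is_walk ends x p.1 (map fst p.2), last x p.1 == y &
      all (fun s => s.2 < c s.1)%N p.2].

Definition flow_le (V E : finType) (ends : E -> V * V) (c : E -> nat) (L : nat) :=
  forall x y : V, x != y -> forall P : seq (seq V * seq (E * nat)),
    all (cap_walk ends c x y) P -> pairwise (@disj _ _) P -> (size P <= L)%N.

(** With unit capacities the only index is 0. A [cap_walk] may repeat vertices, but shortening it to
    a path uses only its own edges, so disjointness survives. *)
Lemma maxmaxflow_flow_le (V E : finType) (ends : E -> V * V) (L : nat) :
  maxmaxflow_le ends L -> flow_le ends (fun=> 1%N) L.
Proof.
move=> H x y xy P alP dP.
have [p|P' [<- al' d']] :=
    @disj_lift _ _ _ _ (fun e => (e, 0%N)) _ (is_path ends x y) _ P alP dP.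
  case/and3P => /walk_shorten[p' pp' /allP sub] /eqP <- /allP c1.
  exists p' => //; apply/allP => e /sub /mapP[[e' i] ein ->] /=.
  by have := c1 _ ein; rewrite /= ltnS leqn0 => /eqP i0; rewrite -[X in (_, X)]i0.
exact: H xy _ al' d'.
Qed.

(** Each unit edge is routed along a walk between the images of its ends, and [pi] recalls which
    unit edge a route serves. Routes can be concatenated freely because [cap_walk] allows repeated
    vertices. *)
Lemma flow_le_transfer (V E V' E' : finType) (ends : E -> V * V)
    (ends' : E' -> V' * V') (c : E -> nat) (c' : E' -> nat) (L : nat)
    (h : V -> V') (pi : E' * nat -> E * nat) :
  injective h ->
  (forall e i x y, joins ends e x y -> (i < c e)%N ->
    exists2 p, cap_walk ends' c' (h x) (h y) p & all (fun s => pi s == (e, i)) p.2) ->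
  flow_le ends' c' L -> flow_le ends c L.
Proof.
move=> injh H flow x y xy P alP dP.
have [p|P' [<- al' d']] :=
    @disj_lift _ _ _ _ pi _ (cap_walk ends' c' (h x) (h y)) _ P alP dP; last first.
  by apply: flow al' d'; rewrite (inj_eq injh).
case: p => vs es /and3P[/= wk /eqP <-].
elim: vs es x wk {xy P alP dP} => [|z vs IH] [|[e i] es] x //=.
  by exists ([::], [::]); rewrite /cap_walk /= ?eqxx.
case/andP=> /H ce wk /andP[/ce[[vs1 es1] /and3P[/= wk1 /eqP la1 c1] sub1] ces].
have [[vs2 es2] /and3P[/= wk2 /eqP la2 c2] sub2] := IH _ _ wk ces.
exists (vs1 ++ vs2, es1 ++ es2).
  by rewrite /cap_walk /= map_cat is_walk_cat ?la1 // last_cat la1 la2 eqxx all_cat c1.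
rewrite /= all_cat; apply/andP; split; apply/allP => s.
  by move/(allP sub1)/eqP->; rewrite mem_head.
by move/(allP sub2); rewrite inE => ->; rewrite orbT.
Qed.

(** * Counting connected components *)

Section Components.
Variables (V E V' E' : finType) (ends : E -> V * V) (ends' : E' -> V' * V').

Lemma comp_rel_sym (A : {set E}) : symmetric (comp_rel ends A).
Proof. by move=> x y; apply: eq_existsb => e; rewrite joinsC. Qed.

Lemma comp_rel_connect_sym (A : {set E}) : connect_sym (comp_rel ends A).
Proof. exact/sym_connect_sym/comp_rel_sym. Qed.

Lemma connect_ends (A : {set E}) e : e \in A ->
  connect (comp_rel ends A) (ends e).1 (ends e).2.
Proof.
by move=> eA; apply: connect1; apply/existsP; exists e; rewrite eA joins_ends.
Qed.

Lemma connect_hom (A : {set E}) (r : rel V') (f : V -> V') : connect_sym r ->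
  (forall e, e \in A -> connect r (f (ends e).1) (f (ends e).2)) ->
  forall x y, connect (comp_rel ends A) x y -> connect r (f x) (f y).
Proof.
move=> symr H x _ /connectP[p + ->]; elim: p x => //= z p IH x /andP[+ /IH].
move=> /existsP[e /andP[/H eA xz]]; apply: connect_trans.
by case/orP: xz eA => /eqP -> //=; rewrite symr.
Qed.

End Components.

(** The maps [h] and [g] induce mutually inverse maps between the two sets of components. *)
Lemma ncomp_retract (V E V' E' : finType) (ends : E -> V * V)
    (ends' : E' -> V' * V') (A : {set E}) (A' : {set E'}) (h : V -> V') (g : V' -> V) :
  cancel h g ->
  (forall e, e \in A ->
     connect (comp_rel ends' A') (h (ends e).1) (h (ends e).2)) ->
  (forall e, e \in A' ->
     connect (comp_rel ends A) (g (ends' e).1) (g (ends' e).2)) ->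
  (forall x, connect (comp_rel ends' A') x (h (g x))) ->
  ncomp ends' A' = ncomp ends A.
Proof.
move=> hK hA gA' hg; have symA' := @comp_rel_connect_sym _ _ ends' A'.
have symA := @comp_rel_connect_sym _ _ ends A.
rewrite /ncomp (adjunction_n_comp h symA' symA) //; last first.
  split=> [x _|x y _]; first by exists (g x).
  apply/idP/idP; first exact: connect_hom.
  by move/(connect_hom symA gA'); rewrite !hK.
Qed.

(** Let [C] be the union of the components of the two ends of [e]. Inside [C] there are two
    components without [e] and one with it; outside [C] a step cannot use [e], so nothing
    changes. *)
Lemma ncomp_bridge (V E : finType) (ends : E -> V * V) (A : {set E}) (e : E) :
  ~~ connect (comp_rel ends A) (ends e).1 (ends e).2 ->
  ncomp ends A = (ncomp ends (e |: A)).+1.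
Proof.
move=> nc; set x := (ends e).1 in nc; set y := (ends e).2 in nc.
set r := comp_rel ends A in nc; set r' := comp_rel ends (e |: A).
have rsym : symmetric r := comp_rel_sym ends A.
have r'sym : symmetric r' := comp_rel_sym ends (e |: A).
have symr := sym_connect_sym rsym; have symr' := sym_connect_sym r'sym.
have xy : connect r' x y by apply: connect_ends; rewrite setU11.
have sub : subrel (connect r) (connect r').
  move=> a b; apply: (connect_hom (f := id)) => // f fA.
  by apply: connect_ends; rewrite setU1r.
pose C := closure r (pred2 x y).
have inC z : (z \in C) = connect r x z || connect r y z.
  apply/existsP/orP => [[t /andP[/= zt]]|].
    by rewrite !inE => /orP[]/eqP <-; [left|right]; rewrite symr.
  by case=> H; [exists x|exists y]; rewrite !inE eqxx ?orbT symr H.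
have clC : closed r C by exact: closure_closed.
have r'r a b : a \notin C -> r' a b -> r a b.
  move=> aC /existsP[f /andP[]]; rewrite in_setU1 => /predU1P[->|fA] fab; last first.
    by apply/existsP; exists f; rewrite fA.
  case/negP: aC; rewrite inC; case/orP: fab => /eqP; rewrite /x /y => -> /=.
    by rewrite connect0.
  by rewrite connect0 orbT.
have clC' : closed r' C.
  apply: intro_closed => // a b ab aC; apply: contraLR aC => bC.
  by rewrite (clC a b) // rsym r'r // r'sym.
rewrite /ncomp -/r -/r' (n_compC C) (n_compC C r') n_comp_closure2 // nc /=.
have -> : n_comp r' C = 1%N.
  rewrite -(n_comp_connect symr' x); apply: eq_n_comp_r => z.
  apply/idP/idP; last first.
    by move=> /(closed_connect clC') <-; rewrite inC connect0.
  rewrite inC => /orP[]/sub; first exact.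
  exact: connect_trans.
rewrite add2n add1n; congr _.+2.
rewrite (adjunction_n_comp id symr symr') //; first exact: predC_closed.
split=> [z _|a b aC]; first by exists z.
apply/idP/idP; last exact: sub.
case/connectP=> p + ->; elim: p a aC => //= z p IH a aC /andP[/(r'r _ _ aC) az].
move=> /IH H; apply: connect_trans (connect1 az) (H _).
by rewrite -(predC_closed clC az).
Qed.

(** * Flow bounds under reductions, and bridges *)

Section Flow.
Variables (V E : finType) (ends : E -> V * V) (L : nat).

(** Parallel capacities add: the first [c' (Some e0)] units of [e0] travel on [Some e0] and the
    others on [None], whence the index shift in [pi]. *)
Lemma flow_le_par (e0 : E) (c : E -> nat) (c' : option E -> nat) :
  flow_le (par_ends ends e0) c' L ->
  (forall e, e != e0 -> c e <= c' (Some e))%N ->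
  (c e0 <= c' (Some e0) + c' None)%N -> flow_le ends c L.
Proof.
move=> + cc cc0; pose pi s : E * nat :=
  if s.1 is Some e then (e, s.2) else (e0, (c' (Some e0) + s.2)%N).
apply: (@flow_le_transfer _ _ _ _ _ _ _ _ _ id pi) => // e i x y exy ic.
have [ic'|ic'] := ltnP i (c' (Some e)).
  exists ([:: y], [:: (Some e, i)]); last by rewrite /= eqxx.
  by rewrite /cap_walk /= ic' eqxx !andbT.
have ee0 : e = e0.
  by apply/eqP; apply: contraLR ic => /cc /leq_trans/(_ ic'); rewrite -leqNgt.
rewrite {e}ee0 in exy ic ic' *.
exists ([:: y], [:: (None, i - c' (Some e0))%N]); last by rewrite /= /pi /= subnKC ?eqxx.
rewrite /cap_walk /= eqxx !andbT; apply/andP; split; first exact: exy.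
by rewrite ltn_subLR // (leq_trans ic cc0).
Qed.

(** Unit [i] of [e0] occupies unit [i] of both halves, so series capacities combine by the
    minimum. *)
Lemma flow_le_subdiv (e0 : E) (c : E -> nat) (c' : option E -> nat) :
  flow_le (subdiv_ends ends e0) c' L ->
  (forall e, c e <= c' (Some e))%N -> (c e0 <= c' None)%N -> flow_le ends c L.
Proof.
move=> + cc cc0; pose pi s : E * nat :=
  if s.1 is Some e then (e, s.2) else (e0, s.2).
apply: (@flow_le_transfer _ _ _ _ _ _ _ _ _ Some pi) => // [? ? []//|e i x y exy ic].
have ic' := leq_trans ic (cc e).
have [ee0|ne] := eqVneq e e0; last first.
  exists ([:: Some y], [:: (Some e, i)]); last by rewrite /= eqxx.
  rewrite /cap_walk /= ic' eqxx !andbT /joins /= (negPf ne).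
  by case/orP: exy => /eqP -> /=; rewrite eqxx ?orbT.
rewrite {e}ee0 in exy ic ic' *; have ic0 := leq_trans ic cc0.
case/orP: exy => /eqP e0xy.
  exists ([:: None; Some y], [:: (Some e0, i); (None, i)]); last by rewrite /= eqxx.
  by rewrite /cap_walk /= ic' ic0 eqxx /joins /= eqxx e0xy !eqxx ?orbT.
exists ([:: None; Some y], [:: (None, i); (Some e0, i)]); last by rewrite /= eqxx.
by rewrite /cap_walk /= ic' ic0 eqxx /joins /= eqxx e0xy !eqxx ?orbT.
Qed.

(** A walk between the ends of [e] avoiding [e] would add one to the [c e >= L] unit copies of [e].
    Positivity of [c] lets it use index 0 on every edge. *)
Lemma flow_le_bridge (c : E -> nat) (e : E) :
  flow_le ends c L -> (forall f, 0 < c f)%N -> (L <= c e)%N ->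
  (ends e).1 != (ends e).2 ->
  ~~ connect (comp_rel ends (~: [set e])) (ends e).1 (ends e).2.
Proof.
move=> flow c0 Lc ne; apply/negP => /connect_walk[vs [es [wk la al]]].
pose P0 := [seq ([:: (ends e).2], [:: (e, i)]) | i <- iota 0 (c e)].
pose p := (vs, [seq (f, 0%N) | f <- es]).
have := flow _ _ ne (p :: P0).
rewrite /= size_map size_iota (leqNgt _ L) ltnS Lc => H; suff: ~~ true by []; apply: H.
- rewrite /cap_walk /= -map_comp map_id wk la eqxx /=; apply/andP; split.
    by apply/allP => s /mapP[f _ ->] /=.
  apply/allP => r /mapP[i]; rewrite mem_iota /= add0n => ic ->.
  by rewrite /= joins_ends ic eqxx.
- apply/andP; split.
    apply/allP => r /mapP[i _ ->] /=; apply/allP => s /mapP[f fes ->].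
    by have := allP al _ fes; rewrite !inE xpair_eqE => /negPf ->.
  rewrite pairwise_map; have := iota_uniq 0 (c e); rewrite uniq_pairwise.
  by apply: sub_pairwise => i j /= ij; rewrite /disj /= andbT inE xpair_eqE eqxx.
Qed.

End Flow.

Lemma flow_le_iso (V E V' E' : finType) (ends : E -> V * V) (ends' : E' -> V' * V')
    (fV : V -> V') (fE : E -> E') (c : E' -> nat) (L : nat) :
  injective fV -> bijective fE ->
  (forall e, ends' (fE e) = (fV (ends e).1, fV (ends e).2) \/
             ends' (fE e) = (fV (ends e).2, fV (ends e).1)) ->
  flow_le ends' c L -> flow_le ends (c \o fE) L.
Proof.
move=> injV [gE fEK gEK] H; pose pi (s : E' * nat) := (gE s.1, s.2).
apply: (@flow_le_transfer _ _ _ _ _ _ _ _ _ fV pi) => // e i x y exy ic.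
exists ([:: fV y], [:: (fE e, i)]); last by rewrite /= /pi /= fEK eqxx.
rewrite /cap_walk /= ic eqxx !andbT /joins.
by case: (H e) => ->; case/orP: exy => /eqP -> /=; rewrite eqxx ?orbT.
Qed.

(** * The Tutte polynomial at bridges and under parallel reduction *)

Lemma big_setU1_split (R : nmodType) (T : finType) (e : T) (F : {set T} -> R) :
  \sum_(A : {set T}) F A = \sum_(A : {set T} | e \notin A) (F A + F (e |: A)).
Proof.
rewrite (bigID (fun A : {set T} => e \notin A)) big_split /=; congr (_ + _).
rewrite (reindex_onto (fun A => e |: A) (fun A => A :\ e)) /=; last first.
  by move=> A; rewrite negbK => /setD1K.
apply: eq_bigl => A; rewrite setU11 /=; apply/eqP/idP => [<-|/setU1K //].
by rewrite setD11.
Qed.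

Lemma big_option_set (R : nmodType) (T : finType) (F : {set option T} -> R) :
  \sum_(A : {set option T}) F A =
  \sum_(A : {set T}) (F (Some @: A) + F (None |: Some @: A)).
Proof.
have SomeI : injective (@Some T) by move=> ? ? [].
rewrite (big_setU1_split None).
rewrite (reindex_onto (fun A : {set T} => Some @: A) (fun A => Some @^-1: A)) /=.
  apply: eq_bigl => A; apply/andP; split; first by apply/imsetP => -[].
  by apply/eqP/setP => x; rewrite inE mem_imset.
move=> A NA; apply/setP => -[x|]; first by rewrite mem_imset // inE.
by rewrite (negPf NA); apply/imsetP => -[].
Qed.

Section Zpoly.
Variables (V E : finType) (ends : E -> V * V) (R : comPzRingType) (q : R).
Implicit Types (A : {set E}) (v : E -> R).

Definition set_weight v (e : E) (w : R) (f : E) : R := if f == e then w else v f.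

Lemma Zpoly_split v e :
  Zpoly ends q v = \sum_(A : {set E} | e \notin A)
    (q ^+ ncomp ends A + v e * q ^+ ncomp ends (e |: A)) * \prod_(f in A) v f.
Proof.
rewrite /Zpoly (big_setU1_split e); apply: eq_bigr => A eA.
by rewrite big_setU1 //=; ring.
Qed.

Lemma prod_set_weight v e w A : e \notin A ->
  \prod_(f in A) set_weight v e w f = \prod_(f in A) v f.
Proof.
move=> eA; apply: eq_bigr => f fA; rewrite /set_weight.
by rewrite (negPf (memPn eA _ fA)).
Qed.

(** Weight 0 stands for deletion. When [e] is a bridge, each [A] avoiding [e] has one component more
    than [e |: A], so [q + v e] factors out of each pair of terms. *)
Lemma Zpoly_bridge v e :
  ~~ connect (comp_rel ends (~: [set e])) (ends e).1 (ends e).2 ->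
  q * Zpoly ends q v = (q + v e) * Zpoly ends q (set_weight v e 0).
Proof.
move=> br; rewrite !(Zpoly_split _ e) !big_distrr; apply: eq_bigr => A eA.
rewrite /= prod_set_weight // /set_weight eqxx mul0r addr0 (@ncomp_bridge _ _ _ A e).
  by rewrite exprS; ring.
apply: contra br; apply: (connect_hom (f := id)); first exact: comp_rel_connect_sym.
move=> f fA; apply: connect_ends; rewrite !inE; by apply: contraNneq eA => <-.
Qed.

Lemma big_option_split (e0 : E) (F : {set option E} -> R) :
  \sum_(A : {set option E}) F A =
  \sum_(A : {set E} | e0 \notin A)
     (F (Some @: A) + F (Some e0 |: Some @: A)
      + (F (None |: Some @: A) + F (Some e0 |: (None |: Some @: A)))).
Proof.
rewrite big_option_set (big_setU1_split e0); apply: eq_bigr => A _.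
by rewrite imsetU1 addrACA (setUCA [set None]).
Qed.

Lemma mem_imset_Some (e0 : E) A : (Some e0 \in Some @: A) = (e0 \in A).
Proof. by apply: mem_imset => ? ? []. Qed.

Lemma None_imset_Some A : (None \in Some @: A) = false.
Proof. by apply/imsetP => -[]. Qed.

Lemma prod_imset_Some (v : option E -> R) A :
  \prod_(f in Some @: A) v f = \prod_(f in A) v (Some f).
Proof. by rewrite big_imset //= => ? ? _ _ []. Qed.

Lemma eq_ncomp_imset (E' : finType) (ends' : E' -> V * V) A (A' : {set E'}) :
  ends' @: A' = ends @: A -> ncomp ends' A' = ncomp ends A.
Proof.
move=> im; apply: (@ncomp_retract _ _ _ _ _ _ _ _ id id) => // e eA.
  have /imsetP[f fA ->] : ends e \in ends' @: A' by rewrite im imset_f.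
  exact: connect_ends.
have /imsetP[f fA ->] : ends' e \in ends @: A by rewrite -im imset_f.
exact: connect_ends.
Qed.

(** One parallel edge or both connect the same vertices, so three of the four cases have equal
    component counts and their weights add up. *)
Lemma Zpoly_par (e0 : E) (v : option E -> R) :
  Zpoly (par_ends ends e0) q v =
  Zpoly ends q (set_weight (v \o Some) e0
    (v (Some e0) + v None + v (Some e0) * v None)).
Proof.
rewrite /Zpoly (big_option_split e0) -/(Zpoly _ _ _) (Zpoly_split _ e0).
apply: eq_bigr => A eA; rewrite prod_set_weight // /set_weight eqxx.
have im1 : par_ends ends e0 @: (Some @: A) = ends @: A.
  by rewrite -imset_comp; apply: eq_imset.
rewrite !big_setU1 ?in_setU1 ?mem_imset_Some ?None_imset_Some //= !prod_imset_Some.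
have nc (A' : {set option E}) : par_ends ends e0 @: A' = ends e0 |: ends @: A ->
    ncomp (par_ends ends e0) A' = ncomp ends (e0 |: A).
  by move=> im; apply: eq_ncomp_imset; rewrite imsetU1.
rewrite (eq_ncomp_imset im1) !nc ?imsetU1 ?im1 ?setUA ?setUid //.
by rewrite /=; ring.
Qed.

End Zpoly.

(** * The Tutte polynomial under series reduction *)

Section Series.
Variables (V E : finType) (ends : E -> V * V) (e0 : E).
Implicit Types A B : {set E}.
Let D := subdiv_ends ends e0.

Lemma subdiv_connect_Some A (A' : {set option E}) (e : E) :
  e0 \notin A -> Some @: A \subset A' -> e \in A ->
  connect (comp_rel D A') (Some (ends e).1) (Some (ends e).2).
Proof.
move=> e0A sub eA; have := @connect_ends _ _ D A' (Some e) (subsetP sub _ (imset_f _ eA)).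
by rewrite /= (negPf (memPn e0A _ eA)).
Qed.

Lemma subdiv_retract_Some A B (e : E) (x : V) : e0 \notin A -> A \subset B ->
  e \in A ->
  connect (comp_rel ends B) (odflt x (D (Some e)).1) (odflt x (D (Some e)).2).
Proof.
move=> e0A /subsetP AB eA; rewrite /= (negPf (memPn e0A _ eA)) /=.
exact/connect_ends/AB.
Qed.

(** The new vertex [None] is a leaf attached to [(ends e0).1], and the retraction sends it there. *)
Lemma ncomp_subdiv_fst A : e0 \notin A ->
  ncomp D (Some e0 |: Some @: A) = ncomp ends A.
Proof.
move=> e0A; set A' := Some e0 |: _.
have c0 : connect (comp_rel D A') (Some (ends e0).1) None.
  by have := @connect_ends _ _ D A' (Some e0) (setU11 _ _); rewrite /= eqxx.
apply: (@ncomp_retract _ _ _ _ _ _ _ _ Some (odflt (ends e0).1)) => // [e eA|e|[x|]] /=.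
- by apply: subdiv_connect_Some eA; rewrite ?subsetUr.
- case/setU1P => [->|/imsetP[f fA ->]]; first by rewrite /= eqxx.
  exact: subdiv_retract_Some fA.
- exact: connect0.
- by rewrite comp_rel_connect_sym.
Qed.

Lemma ncomp_subdiv_snd A : e0 \notin A ->
  ncomp D (None |: Some @: A) = ncomp ends A.
Proof.
move=> e0A; set A' := None |: _.
have c0 : connect (comp_rel D A') None (Some (ends e0).2).
  exact: (@connect_ends _ _ D A' None (setU11 _ _)).
apply: (@ncomp_retract _ _ _ _ _ _ _ _ Some (odflt (ends e0).2)) => // [e eA|e|[x|]] /=.
- by apply: subdiv_connect_Some eA; rewrite ?subsetUr.
- case/setU1P => [->|/imsetP[f fA ->]]; first exact: connect0.
  exact: subdiv_retract_Some fA.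
- exact: connect0.
- exact: c0.
Qed.

Lemma ncomp_subdiv_both A : e0 \notin A ->
  ncomp D (Some e0 |: (None |: Some @: A)) = ncomp ends (e0 |: A).
Proof.
move=> e0A; set A' := Some e0 |: _.
have sub : Some @: A \subset A' by rewrite /A' setUA subsetUr.
have c1 : connect (comp_rel D A') (Some (ends e0).1) None.
  by have := @connect_ends _ _ D A' (Some e0) (setU11 _ _); rewrite /= eqxx.
have c2 : connect (comp_rel D A') None (Some (ends e0).2).
  by apply: (@connect_ends _ _ D A' None); rewrite setU1r ?setU11.
apply: (@ncomp_retract _ _ _ _ _ _ _ _ Some (odflt (ends e0).1)) => // [e|e|[x|]] /=.
- case/setU1P => [->|eA]; first exact: connect_trans c1 c2.
  exact: subdiv_connect_Some eA.
- case/setU1P => [->|/setU1P[->|/imsetP[f fA ->]]]; first by rewrite /= eqxx.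
    exact/connect_ends/setU11.
  by apply: subdiv_retract_Some fA; rewrite ?subsetUr.
- exact: connect0.
- by rewrite comp_rel_connect_sym.
Qed.

Lemma ncomp_subdiv_none A : e0 \notin A ->
  ncomp D (Some @: A) = (ncomp ends A).+1.
Proof.
move=> e0A; rewrite -(ncomp_subdiv_fst e0A); apply: ncomp_bridge.
rewrite /= eqxx /=; apply/negP.
(* No edge of [Some @: A] touches the new vertex, so [isSome] would carry the connection to the
   empty relation on booleans. *)
move/(@connect_hom _ _ _ D _ (fun _ _ => false) isSome) => H.
have /connectP[[|//] _ //] : connect (fun _ _ : bool => false) true false.
apply: H => [|f /imsetP[e eA ->]]; first exact: sym_connect_sym.
by rewrite /= (negPf (memPn e0A _ eA)) connect0.
Qed.

(** With neither half present the new vertex is isolated and gives an extra [q]; with one half it is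
    a leaf. These cases add up to [q + v (Some e0) + v None], and the case of both halves acts as
    [e0] present. *)
Lemma Zpoly_subdiv (F : fieldType) (q : F) (v : option E -> F) :
  q + v (Some e0) + v None != 0 ->
  Zpoly D q v = (q + v (Some e0) + v None) *
    Zpoly ends q (set_weight (v \o Some) e0
      (v (Some e0) * v None / (q + v (Some e0) + v None))).
Proof.
move=> s0; rewrite {1}/Zpoly (big_option_split e0) (Zpoly_split _ _ _ e0) big_distrr.
apply: eq_bigr => A eA; rewrite /= prod_set_weight // /set_weight eqxx.
rewrite !big_setU1 ?in_setU1 ?mem_imset_Some ?None_imset_Some //= !prod_imset_Some.
rewrite ncomp_subdiv_none // ncomp_subdiv_fst // ncomp_subdiv_snd // ncomp_subdiv_both //.
by rewrite exprS; field.
Qed.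

End Series.

(** * Isomorphisms, forests and the induction on the construction *)

Lemma Zpoly_iso (V E V' E' : finType) (ends : E -> V * V) (ends' : E' -> V' * V')
    (fV : V -> V') (fE : E -> E') (R : comPzRingType) (q : R) (v : E' -> R) :
  bijective fV -> bijective fE ->
  (forall e, ends' (fE e) = (fV (ends e).1, fV (ends e).2) \/
             ends' (fE e) = (fV (ends e).2, fV (ends e).1)) ->
  Zpoly ends' q v = Zpoly ends q (v \o fE).
Proof.
move=> [gV fVK gVK] [gE fEK gEK] H; have injE := can_inj fEK.
rewrite /Zpoly (reindex (fun A : {set E} => fE @: A)) /=; last first.
  exists (fun A : {set E'} => gE @: A) => A _; rewrite -imset_comp.
    by rewrite (eq_imset _ fEK) imset_id.
  by rewrite (eq_imset _ gEK) imset_id.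
apply: eq_bigr => A _; rewrite big_imset //=; last by move=> ? ? _ _ /injE.
congr (_ ^+ _ * _).
apply: (@ncomp_retract _ _ _ _ _ _ _ _ fV gV) => // [e eA|_ /imsetP[e eA ->]|x].
- have := @connect_ends _ _ ends' _ _ (imset_f fE eA).
  by case: (H e) => -> //=; rewrite comp_rel_connect_sym.
- have := connect_ends ends eA.
  by case: (H e) => -> /=; rewrite !fVK // comp_rel_connect_sym.
- by rewrite gVK connect0.
Qed.

Lemma Zpoly_weight0 (V E : finType) (ends : E -> V * V) (R : comPzRingType) (q : R) :
  Zpoly ends q (fun=> 0) = q ^+ ncomp ends set0.
Proof.
rewrite /Zpoly (bigD1 set0) //= big_set0 mulr1 big1 ?addr0 // => A.
by case/set0Pn => e eA; rewrite (bigD1 e) //= mul0r mulr0.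
Qed.

(** A second route between the ends, shortened to a path, would close up with [e] to a cycle. *)
Lemma forest_bridge (V E : finType) (ends : E -> V * V) (e : E) : forest ends ->
  ~~ connect (comp_rel ends (~: [set e])) (ends e).1 (ends e).2.
Proof.
move=> fo; rewrite comp_rel_connect_sym; apply/negP.
case/connect_walk => vs [es [wk la al]].
have [[vs' es'] /and3P[/= wk' la' un] /allP sub] := walk_shorten wk.
apply/negP: (fo (ends e).1 ((ends e).2 :: vs') (e :: es')); rewrite negbK.
rewrite /is_cycle /= joins_ends wk' (eqP la') la eqxx (is_walk_uniq wk' un).
move: un => /= /andP[-> ->] /=; rewrite andbT; apply/negP => /sub /(allP al).
by rewrite !inE eqxx.
Qed.

(** Gives the distinct ends required by [flow_le_bridge] in every intermediate graph of the
    induction. *)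
Lemma series_parallel_loopless (V E : finType) (ends : E -> V * V) :
  series_parallel ends -> loopless ends.
Proof.
elim=> {V E ends} [V E ends fo e|V E ends e0 _ IH [e|]|V E ends e0 _ IH [e|]|].
- by apply/eqP => e12; have := forest_bridge e fo; rewrite e12 connect0.
- by rewrite /=; case: (e == e0) => //; exact: IH.
- by [].
- exact: IH.
- exact: IH.
- move=> V E V' E' ends ends' fV fE [gV fVK _] [gE _ gEK] H _ IH e.
  rewrite -(gEK e); case: (H (gE e)) => -> /=; rewrite (can_eq fVK) //.
  by rewrite eq_sym.
Qed.

Lemma eq_Zpoly (V E : finType) (ends : E -> V * V) (R : comPzRingType) (q : R)
    (v w : E -> R) : v =1 w -> Zpoly ends q v = Zpoly ends q w.
Proof.
by move=> vw; apply: eq_bigr => A _; congr (_ * _); apply: eq_bigr => e _; exact: vw.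
Qed.

Lemma Zpoly_bridge_neq0 (V E : finType) (ends : E -> V * V) (F : fieldType)
    (q : F) (v : E -> F) (e : E) :
  ~~ connect (comp_rel ends (~: [set e])) (ends e).1 (ends e).2 ->
  q + v e != 0 -> Zpoly ends q (set_weight v e 0) != 0 -> Zpoly ends q v != 0.
Proof.
move=> br qe Z0; have := mulf_neq0 qe Z0.
by rewrite -Zpoly_bridge //; apply: contraNneq => ->; rewrite mulr0.
Qed.

Lemma Zpoly_forest_neq0 (V E : finType) (ends : E -> V * V) (F : fieldType)
    (q : F) (v : E -> F) :
  forest ends -> q != 0 -> (forall e, q + v e != 0) -> Zpoly ends q v != 0.
Proof.
(* [w s] deletes the edges in [s]. Starting with all edges deleted, they are restored one by one,
   each being a bridge. *)
move=> fo q0 qv; pose w (s : seq E) e := if e \in s then 0 else v e.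
suff H s : Zpoly ends q (w s) != 0 -> Zpoly ends q v != 0.
  apply: (H (enum E)); rewrite (@eq_Zpoly _ _ _ _ _ _ (fun=> 0)).
    by rewrite Zpoly_weight0 expf_neq0.
  by move=> e; rewrite /w mem_enum.
elim: s => [|e s IH] Z0; first exact: Z0.
apply/IH/(@Zpoly_bridge_neq0 _ _ _ _ _ _ e); first exact: forest_bridge.
  by rewrite /w; case: ifP; rewrite ?addr0.
rewrite (@eq_Zpoly _ _ _ _ _ _ (w (e :: s))) // => f.
by rewrite /w /set_weight inE; case: (f == e).
Qed.

(** [Good c w] isolates what the analysis must supply. Closure under parallel connection is asked
    only up to [M], one below the flow bound; beyond it, only [q + w != 0] is needed. *)
Lemma Zpoly_series_parallel_neq0 (F : fieldType) (q : F) (M : nat)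
    (Good : nat -> F -> Prop) :
  q != 0 -> Good 1%N 0 ->
  (forall c w, Good c w -> (0 < c)%N /\ q + w != 0) ->
  (forall c1 c2 w1 w2, Good c1 w1 -> Good c2 w2 ->
     q + (w1 + w2 + w1 * w2) != 0) ->
  (forall c1 c2 w1 w2, Good c1 w1 -> Good c2 w2 -> (c1 + c2 <= M)%N ->
     Good (c1 + c2)%N (w1 + w2 + w1 * w2)) ->
  (forall c1 c2 w1 w2, Good c1 w1 -> Good c2 w2 ->
     q + w1 + w2 != 0 /\ Good (minn c1 c2) (w1 * w2 / (q + w1 + w2))) ->
  forall (V E : finType) (ends : E -> V * V), series_parallel ends ->
  forall (c : E -> nat) (v : E -> F), (forall e, Good (c e) (v e)) ->
  flow_le ends c M.+1 -> Zpoly ends q v != 0.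
Proof.
move=> q0 G0 Gq Gpar0 Gpar Gser V E ends; elim=> {V E ends}.
- move=> V E ends fo c v Gv _; apply: Zpoly_forest_neq0 => // e.
  by case: (Gq _ _ (Gv e)).
- move=> V E ends e0 _ IH c v Gv flow.
  have [s0 Gs] := Gser _ _ _ _ (Gv (Some e0)) (Gv None).
  rewrite Zpoly_subdiv // mulf_neq0 //.
  apply: (IH (fun e => if e == e0 then minn (c (Some e0)) (c None) else c (Some e))).
    by move=> e; rewrite /set_weight; case: ifP => // _; exact: Gv.
  apply: flow_le_subdiv flow _ _ => [e|]; last by rewrite eqxx geq_minr.
  by case: eqP => // ->; rewrite geq_minl.
- move=> V E ends e0 sp IH c v Gv flow; rewrite Zpoly_par.
  set w := _ + _ + _; set C := (c (Some e0) + c None)%N.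
  have [CM|MC] := leqP C M.
    apply: (IH (fun e => if e == e0 then C else c (Some e))).
      move=> e; rewrite /set_weight; case: ifP => _; last exact: Gv.
      exact: Gpar.
    by apply: flow_le_par flow _ _ => [e /negPf ->|] //; rewrite eqxx.
  (* Now [C >= M.+1], so [e0] is a bridge. After its deletion it stays as an edge of weight 0 and
     capacity 1, which is good by [G0]. *)
  have loop := series_parallel_loopless sp.
  apply: (@Zpoly_bridge_neq0 _ _ _ _ _ _ e0); last first.
  + apply: (IH (fun e => if e == e0 then 1%N else c (Some e))).
      move=> e; rewrite /set_weight; case: ifP => // _; exact: Gv.
    apply: flow_le_par flow _ _ => [e /negPf ->|] //; rewrite eqxx.
    by apply: leq_trans (leq_addr _ _); case: (Gq _ _ (Gv (Some e0))).
  + by rewrite /set_weight eqxx; apply: Gpar0 (Gv _) (Gv _).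
  + apply: (@flow_le_bridge _ _ _ M.+1 (fun e => if e == e0 then C else c (Some e))) => //.
    * by apply: flow_le_par flow _ _ => [e /negPf ->|] //; rewrite eqxx.
    * move=> e; case: ifP => _; last by case: (Gq _ _ (Gv (Some e))).
      by apply: leq_trans (leq_addr _ _); case: (Gq _ _ (Gv (Some e0))).
    * by rewrite eqxx.
- move=> V E V' E' ends ends' fV fE bV bE H _ IH c v Gv flow.
  rewrite (Zpoly_iso _ _ bV bE H); apply: (IH (c \o fE)) => [e|]; first exact: Gv.
  exact: flow_le_iso (bij_inj bV) bE H flow.
Qed.

(** The ratio [(Z^(n+1) - 1) / (Z^n - 1) = 1 + Z^n / (1 + ... + Z^(n-1))] increases with [Z]; after
    cancelling [(a - 1) (b - 1)] the comparison is termwise. *)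
Lemma leM_exprB1 (R : numDomainType) (a b : R) (n : nat) : 1 <= a -> a <= b ->
  (a ^+ n.+1 - 1) * (b ^+ n - 1) <= (b ^+ n.+1 - 1) * (a ^+ n - 1).
Proof.
move=> a1 ab; have b1 := le_trans a1 ab.
have a0 : 0 <= a := le_trans ler01 a1; have b0 := le_trans a0 ab.
rewrite !subrX1 !big_ord_recr /=.
set s := \sum_(i < n) a ^+ i; set t := \sum_(i < n) b ^+ i.
rewrite -subr_ge0.
have -> : (b - 1) * (t + b ^+ n) * ((a - 1) * s) - (a - 1) * (s + a ^+ n) * ((b - 1) * t)
  = (a - 1) * (b - 1) * (b ^+ n * s - a ^+ n * t) by ring.
rewrite mulr_ge0 ?mulr_ge0 ?subr_ge0 // !big_distrr /=; apply: ler_sum => i _.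
have split_exp x : x ^+ n = x ^+ i * x ^+ (n - i) :> R.
  by rewrite -exprD subnKC // ltnW.
rewrite !split_exp -subr_ge0.
have -> : b ^+ i * b ^+ (n - i) * a ^+ i - a ^+ i * a ^+ (n - i) * b ^+ i =
  a ^+ i * b ^+ i * (b ^+ (n - i) - a ^+ (n - i)) by ring.
by rewrite mulr_ge0 ?mulr_ge0 ?exprn_ge0 // subr_ge0 lerXn2r.
Qed.

(** * Disc estimates for series and parallel connection *)

Section Discs.
Variables (C : numClosedFieldType) (q X : C) (M : nat).
Let k : C := `|q - 1|.
Hypotheses (k1 : 1 < k) (X1 : 1 <= X) (M0 : (0 < M)%N).
(** With [r_c = (X^c - 1) / (k - X^c)], [XM] says [r_M = 1 / k] and [XK] says [r_1 >= 1 / k^2]. *)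
Hypothesis XM : X ^+ M * (1 + k) = 2 * k.
Hypothesis XK : k + k ^+ 2 <= X * (1 + k ^+ 2).

(* In terms of [t = (z - 1) / (z + q - 1)] this reads
   [|t| <= rho * (X^c - 1) / (1 - rho * X^c)] with [rho = 1 / k]. *)
Definition in_disc (c : nat) (z : C) : Prop :=
  z + (q - 1) != 0 /\
  (k - X ^+ c) * `|z - 1| <= (X ^+ c - 1) * `|z + (q - 1)|.

Definition admissible (c : nat) (w : C) : Prop :=
  (0 < c <= M)%N /\
  exists a z, [/\ 0 <= a <= 1, 1 + w = a * z & in_disc c z].

Let k0 : 0 < k. Proof. exact: lt_trans ltr01 k1. Qed.

Lemma q_neq0 : q != 0.
Proof.
by apply: contraTneq k1 => q0; rewrite /k q0 sub0r normrN1 ltxx.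
Qed.

Lemma exprX_ge1 c : 1 <= X ^+ c.
Proof. exact: exprn_ege1. Qed.

Lemma exprX_lt c : (c <= M)%N -> X ^+ c < k.
Proof.
move=> cM; apply: (@le_lt_trans _ _ (X ^+ M)); first exact: ler_weXn2l.
rewrite -(ltr_pM2r (addr_gt0 ltr01 k0)) XM mulrC ltr_pM2l //.
by rewrite ltrD2l.
Qed.

(** Radii increase with [c] up to [r_M = 1 / k]; multiplied by [1 + k], the inequality for [r_M]
    becomes [(k - 1) (n - k m) >= 0]. *)
Lemma disc_bound c (m n : C) : (c <= M)%N -> 0 <= m -> 0 <= n ->
  (k - X ^+ c) * m <= (X ^+ c - 1) * n -> k * m <= n.
Proof.
move=> cM m0 n0 h; have le : X ^+ c <= X ^+ M by exact: ler_weXn2l.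
have {}h : (k - X ^+ M) * m <= (X ^+ M - 1) * n.
  apply: le_trans (le_trans h _); first by rewrite ler_wpM2r // lerD2l lerN2.
  by rewrite ler_wpM2r // lerD2r.
have k10 : 0 < k - 1 by rewrite subr_gt0.
rewrite -(ler_pM2l k10) -subr_ge0.
have -> : (k - 1) * n - (k - 1) * (k * m) =
   (1 + k) * ((X ^+ M - 1) * n - (k - X ^+ M) * m).
  have -> : (k - 1) = X ^+ M * (1 + k) - (1 + k) by rewrite XM; ring.
  have -> : (X ^+ M * (1 + k) - (1 + k)) * (k * m) = (k + k ^+ 2 - X ^+ M * (1 + k)) * m.
    by rewrite XM; ring.
  by ring.
by rewrite mulr_ge0 ?subr_ge0 // ltW // addr_gt0.
Qed.

Lemma in_disc_bound c z : (c <= M)%N -> in_disc c z -> k * `|z - 1| <= `|z + (q - 1)|.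
Proof. by move=> cM [_]; apply: disc_bound. Qed.

(* The disc [k * |z - 1| <= |z + q - 1|] is convex and contains the origin. *)
Lemma disc_scale (a z : C) : 0 <= a <= 1 -> k * `|z - 1| <= `|z + (q - 1)| ->
  k * `|a * z - 1| <= `|a * z + (q - 1)|.
Proof.
case/andP=> a0 a1; set Q := q - 1.
have kk : k ^+ 2 = Q * Q^* by rewrite -normCK.
clearbody Q.
have sq (u : C) : (k * `|u - 1| <= `|u + Q|) =
    (0 <= (u + Q) * (u + Q)^* - k ^+ 2 * ((u - 1) * (u - 1)^*)).
  rewrite -(@ler_pXn2r _ 2) // ?nnegrE ?mulr_ge0 ?(ltW k0) //.
  by rewrite exprMn !normCK subr_ge0.
have aC : a^* = a by apply/CrealP/ger0_real.
rewrite !sq !rmorphB !rmorphD !rmorphM rmorph1 /= aC.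
set zc := z^*; set Qc := Q^*; rewrite -/Qc in kk.
set f := (z + Q) * (zc + Qc) - _ => f0.
(* The constant term vanishes since [|Q| = k], and the quadratic coefficient [1 - k^2] is negative,
   so scaling by [a] leaves a nonnegative remainder. *)
have -> : (a * z + Q) * (a * zc + Qc) - k ^+ 2 * ((a * z - 1) * (a * zc - 1)) =
   a * f + a * (1 - a) * ((k ^+ 2 - 1) * (z * zc)) by rewrite /f kk; ring.
apply: addr_ge0; first exact: mulr_ge0.
apply: mulr_ge0; first by rewrite mulr_ge0 ?subr_ge0.
by rewrite mulr_ge0 ?mul_conjC_ge0 // subr_ge0 exprn_ege1 // ltW.
Qed.

Lemma admissible_bound c w : admissible c w -> k * `|w| <= `|q + w| /\ q + w != 0.
Proof.
case=> /andP[_ cM] [a [z [a01 w1 zD]]].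
have := disc_scale a01 (in_disc_bound cM zD).
have -> : a * z - 1 = w by rewrite -w1; ring.
have -> : a * z + (q - 1) = q + w by rewrite -w1; ring.
move=> kw; split => //; apply: contraTneq kw => qw.
have -> : w = - q by apply/eqP; rewrite -addr_eq0 addrC qw.
have kq : 0 < k * `|q| by rewrite mulr_gt0 // normr_gt0 q_neq0.
by rewrite subrr normr0 normrN lt_geF.
Qed.

(** With [t = w / (q + w)], vanishing would mean [(q - 1) t1 t2 = -1], impossible since
    [|t1|, |t2| <= 1 / k] and [k > 1]. *)
Lemma parallel_neq0 c1 c2 w1 w2 : admissible c1 w1 -> admissible c2 w2 ->
  q + (w1 + w2 + w1 * w2) != 0.
Proof.
move=> /admissible_bound[k1w q1] /admissible_bound[k2w q2].
apply/eqP => h.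
have e : (q + w1) * (q + w2) = - ((q - 1) * w1 * w2).
  have -> : (q + w1) * (q + w2) = q * (q + (w1 + w2 + w1 * w2)) - (q - 1) * w1 * w2 by ring.
  by rewrite h mulr0 sub0r.
have {e} : `|q + w1| * `|q + w2| = k * `|w1| * `|w2|.
  by rewrite -normrM e normrN !normrM.
move=> e; have : `|q + w2| <= `|w2|.
  by rewrite -(@ler_pM2l _ `|q + w1|) ?normr_gt0 // e ler_wpM2r.
move/(le_trans k2w); rewrite -subr_ge0.
have -> : `|w2| - k * `|w2| = - ((k - 1) * `|w2|) by ring.
rewrite oppr_ge0 pmulr_rle0 ?subr_gt0 // normr_le0 => /eqP w20.
move/eqP: e.
by rewrite w20 normr0 mulr0 addr0 mulf_eq0 !normr_eq0 (negPf q1) (negPf q_neq0).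
Qed.

(** A radius [r] fits in the disc exactly when [(1 + k r) / (1 + r) <= X^c], and the worst case of
    parallel connection multiplies these quotients. *)
Lemma admissible_parallel c1 c2 w1 w2 :
  admissible c1 w1 -> admissible c2 w2 -> (c1 + c2 <= M)%N ->
  admissible (c1 + c2) (w1 + w2 + w1 * w2).
Proof.
move=> [/andP[c10 c1M] [a1 [z1 [/andP[a10 a11] wz1 D1]]]].
move=> [/andP[c20 c2M] [a2 [z2 [/andP[a20 a21] wz2 D2]]]] cM.
split; first by rewrite cM addn_gt0 c10.
exists (a1 * a2), (z1 * z2); split.
- by rewrite mulr_ge0 //= mulr_ile1.
- have -> : 1 + (w1 + w2 + w1 * w2) = (1 + w1) * (1 + w2) by ring.
  by rewrite wz1 wz2; ring.
have b1 := in_disc_bound c1M D1; have b2 := in_disc_bound c2M D2.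
case: D1 => nz1 D1; case: D2 => nz2 D2.
set Q := q - 1 in b1 b2 nz1 D1 nz2 D2 *.
set n1 := `|z1 + Q| in b1 D1; set m1 := `|z1 - 1| in b1 D1.
set n2 := `|z2 + Q| in b2 D2; set m2 := `|z2 - 1| in b2 D2.
have n10 : 0 < n1 by rewrite normr_gt0.
have n20 : 0 < n2 by rewrite normr_gt0.
have m10 : 0 <= m1 := normr_ge0 _.
have m20 : 0 <= m2 := normr_ge0 _.
have qQ : q = 1 + Q by rewrite /Q; ring.
have q0 : 0 < `|q| by rewrite normr_gt0 q_neq0.
(* After multiplication by [|q|], the triangle inequality bounds the new denominator below by [n]
   and the new numerator above by [m]. They satisfy [n + m = (n1 + m1) (n2 + m2)] and
   [n + k m = (n1 + k m1) (n2 + k m2)]. *)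
pose n := n1 * n2 - k * m1 * m2.
pose m := n1 * m2 + m1 * n2 + (k + 1) * m1 * m2.
have nn : n <= `|q| * `|z1 * z2 + Q|.
  rewrite -normrM; have -> : q * (z1 * z2 + Q) =
    (z1 + Q) * (z2 + Q) - (- (Q * (z1 - 1) * (z2 - 1))) by rewrite qQ; ring.
  by apply: le_trans (lerB_dist _ _); rewrite normrN !normrM.
have mm : `|q| * `|z1 * z2 - 1| <= m.
  rewrite -normrM; have -> : q * (z1 * z2 - 1) =
    (z1 + Q) * (z2 - 1) + (z1 - 1) * (z2 + Q) + (Q - 1) * (z1 - 1) * (z2 - 1).
    by rewrite qQ; ring.
  apply: le_trans (ler_normD _ _) _; apply: lerD.
    by apply: le_trans (ler_normD _ _) _; rewrite !normrM.
  rewrite !normrM -!mulrA ler_wpM2r ?mulr_ge0 //.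
  by apply: le_trans (ler_normB _ _) _; rewrite normr1.
have n0 : 0 < n.
  rewrite subr_gt0; apply: (@le_lt_trans _ _ (n1 * m2)).
    by rewrite ler_wpM2r.
  rewrite ltr_pM2l // -(ltr_pM2l k0); apply: le_lt_trans b2 _.
  by rewrite ltr_pMl.
set Y1 := X ^+ c1 in D1; set Y2 := X ^+ c2 in D2.
have Y1' : 1 <= Y1 := exprX_ge1 c1; have Y2' : 1 <= Y2 := exprX_ge1 c2.
have Y12 : 1 <= Y1 * Y2 by rewrite -exprD exprX_ge1.
have Yk : Y1 * Y2 < k by rewrite -exprD exprX_lt.
have key (Y n' m' : C) : (k - Y) * m' <= (Y - 1) * n' -> n' + k * m' <= Y * (n' + m').
  rewrite -subr_ge0 => h; rewrite -subr_ge0.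
  by have -> : Y * (n' + m') - (n' + k * m') = (Y - 1) * n' - (k - Y) * m' by ring.
have nm : (k - Y1 * Y2) * m <= (Y1 * Y2 - 1) * n.
  have := ler_pM _ _ (key _ _ _ D1) (key _ _ _ D2).
  rewrite !addr_ge0 ?(ltW n10) ?(ltW n20) ?mulr_ge0 ?(ltW k0) // -subr_ge0 => /(_ isT isT) h.
  rewrite -subr_ge0.
  have -> // : (Y1 * Y2 - 1) * n - (k - Y1 * Y2) * m =
    Y1 * (n1 + m1) * (Y2 * (n2 + m2)) - (n1 + k * m1) * (n2 + k * m2).
  by rewrite /n /m; ring.
split.
  by rewrite -normr_gt0 -(pmulr_rgt0 _ q0); exact: lt_le_trans n0 nn.
rewrite exprD -(ler_pM2l q0) -/Y1 -/Y2 mulrCA [leRHS]mulrCA.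
apply: le_trans (_ : (k - Y1 * Y2) * m <= _).
  by rewrite ler_pM2l // subr_gt0.
by apply: le_trans nm _; rewrite ler_wpM2l // subr_ge0.
Qed.

Lemma admissible_disc1 c w : (0 < c <= M)%N -> q + w != 0 ->
  (k - X) * `|w| <= (X - 1) * `|q + w| -> admissible c w.
Proof.
move=> /andP[c0 cM] qw h; split; first by rewrite c0.
exists 1, (1 + w); rewrite ler01 lexx mul1r; split=> //.
rewrite /in_disc; have -> : 1 + w + (q - 1) = q + w by ring.
split=> //; have -> : 1 + w - 1 = w by ring.
have XXc : X <= X ^+ c by rewrite -[leLHS]expr1 ler_weXn2l.
apply: le_trans (le_trans h _); first by rewrite ler_wpM2r // lerD2l lerN2.
by rewrite ler_wpM2r // lerD2r.
Qed.

(** Transmissivities multiply, so the result has modulus at most [1 / k^2 <= r_1]: it lies in the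
    smallest disc and is admissible for any capacity from 1 to [M]. *)
Lemma admissible_series c1 c2 w1 w2 : admissible c1 w1 -> admissible c2 w2 ->
  q + w1 + w2 != 0 /\ admissible (minn c1 c2) (w1 * w2 / (q + w1 + w2)).
Proof.
move=> A1 A2; have [b1 q1] := admissible_bound A1; have [b2 q2] := admissible_bound A2.
have qs : q * (q + w1 + w2) = (q + w1) * (q + w2) - w1 * w2 by ring.
have le : k ^+ 2 * (`|w1| * `|w2|) <= `|q + w1| * `|q + w2|.
  have -> : k ^+ 2 * (`|w1| * `|w2|) = k * `|w1| * (k * `|w2|) by ring.
  by apply: ler_pM => //; rewrite mulr_ge0 // ltW.
have s0 : q + w1 + w2 != 0.
  apply/eqP => s0; move/eqP: qs; rewrite s0 mulr0 eq_sym subr_eq0 => /eqP e.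
  have p0 : 0 < `|w1| * `|w2| by rewrite -normrM -e normr_gt0 mulf_neq0.
  move: le; rewrite -!normrM e normrM ger_pMl // lt_geF //.
  exact: exprn_egt1.
split=> //; set s := q + w1 + w2 in qs s0 *.
case: (A1) => /andP[c10 c1M] _; case: (A2) => /andP[c20 _] _.
have qw : q + w1 * w2 / s = (q + w1) * (q + w2) / s.
  by rewrite -[(q + w1) * _](subrK (w1 * w2)) -qs mulrDl mulfK.
apply: admissible_disc1.
- by rewrite leq_min c10 c20 geq_min c1M.
- by rewrite qw !mulf_neq0 ?invr_neq0.
rewrite qw !normrM !mulrA ler_wpM2r // -!mulrA.
apply: (@le_trans _ _ ((X - 1) * k ^+ 2 * (`|w1| * `|w2|))); last first.
  by rewrite -mulrA ler_wpM2l // subr_ge0.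
rewrite ler_wpM2r ?mulr_ge0 // -subr_ge0.
have -> : (X - 1) * k ^+ 2 - (k - X) = X * (1 + k ^+ 2) - (k + k ^+ 2) by ring.
by rewrite subr_ge0.
Qed.

(** The point [z = 1] is the centre [t = 0] of every disc, so the whole weight goes into the factor
    [a = 1 + w]. *)
Lemma admissible_real w : -1 <= w <= 0 -> admissible 1 w.
Proof.
move=> /andP[w1 w0]; split; first by rewrite M0.
exists (1 + w), 1; rewrite mulr1; split=> //.
  by rewrite -subr_ge0 opprK in w1; rewrite addrC w1 gerDr.
have e : 1 + (q - 1) = q by ring.
rewrite /in_disc e q_neq0; split=> //.
by rewrite subrr normr0 mulr0 mulr_ge0 // subr_ge0 exprX_ge1.
Qed.

Lemma admissible0 : admissible 1 0.
Proof. by apply: admissible_real; rewrite lexx oppr_le0 ler01. Qed.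

Lemma admissible_transmissivity w : q + w != 0 ->
  `|w / (q + w)| <= 1 / k * ((X - 1) / (1 - 1 / k * X)) -> admissible 1 w.
Proof.
move=> qw h; apply: admissible_disc1 => //.
have Xk : 0 < k - X by rewrite subr_gt0 -[X]expr1 exprX_lt.
have kn0 : k != 0 by rewrite gt_eqF.
have kX0 : k - X != 0 by rewrite gt_eqF.
have e : 1 / k * ((X - 1) / (1 - 1 / k * X)) = (X - 1) / (k - X).
  by field; rewrite kX0 kn0.
move: h; rewrite e normf_div ler_pdivlMr // mulrAC ler_pdivrMr ?normr_gt0 //.
by rewrite mulrC.
Qed.

End Discs.

(** * From the equation of the threshold to the series condition *)

Lemma series_threshold (C : numClosedFieldType) (M : nat) (s k X : C) :
  (1 < M)%N -> 0 < s < 1 -> (1 + s) ^+ M.+1 = 2 * (1 + s ^+ 2) ^+ M ->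
  1 / s <= k -> 0 <= X -> X ^+ M * (1 + k) = 2 * k ->
  k + k ^+ 2 <= X * (1 + k ^+ 2).
Proof.
move=> M1 /andP[s0 s1] hs sk X0 XM; case: M M1 hs XM => // M M1 hs XM.
have k0 : 0 < k by apply: lt_le_trans sk; rewrite divr_gt0.
have k10 : 0 < 1 + k by rewrite addr_gt0.
have s10 : 0 < 1 + s by rewrite addr_gt0.
have s20 : 0 < 1 + s ^+ 2 by rewrite addr_gt0 // exprn_gt0.
have [k1n s1n s2n] : [/\ 1 + k != 0, 1 + s != 0 & 1 + s ^+ 2 != 0] by rewrite !gt_eqF.
(* [Y] turns the goal into an equality at [k = 1 / s], and the equation for [s] makes it the value
   of [X] there. *)
pose Y := (1 + s) / (1 + s ^+ 2).
have YM : Y ^+ M.+1 = 2 / (1 + s).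
  apply: (mulIf s1n); rewrite divfK // expr_div_n mulrAC -exprSr hs mulfK //.
  by rewrite expf_neq0.
have XM' : X ^+ M.+1 = 2 * k / (1 + k) by rewrite -XM mulfK.
have Y1 : 1 < Y.
  by rewrite ltr_pdivlMr // mul1r ltrD2l expr2 gtr_pMr.
have Y0 : 0 <= Y := ltW (lt_trans ltr01 Y1).
have YX : Y <= X.
  rewrite -(@ler_pXn2r _ M.+1) // YM XM' ler_pdivrMr // mulrAC ler_pdivlMr //.
  have ks : 1 <= k * s by rewrite -ler_pdivrMr.
  rewrite -subr_ge0; have -> : 2 * k * (1 + s) - 2 * (1 + k) = 2 * (k * s - 1) by ring.
  by rewrite mulr_ge0 // subr_ge0.
have X1 := lt_le_trans Y1 YX.
(* Monotonicity of [(Z^(M+1) - 1) / (Z^M - 1)] in [Z] carries the identity at [Y], which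
   encodes the equation for [s], to an inequality at [X]. *)
have eY : (Y ^+ M.+1 - 1) ^+ 2 = Y ^+ M - 1.
  apply: (mulfI (lt0r_neq0 (lt_trans ltr01 Y1))).
  rewrite [RHS]mulrBr -exprS YM mulr1 /Y.
  by field; rewrite s1n s2n.
have YMp n : 0 < Y ^+ n.+1 - 1 by rewrite subr_gt0 exprn_egt1.
have XMp n : 0 < X ^+ n.+1 - 1 by rewrite subr_gt0 exprn_egt1.
have bound : X ^+ M - 1 <= (X ^+ M.+1 - 1) ^+ 2.
  case: M M1 {hs XM YM XM'} eY => // M _ eY.
  rewrite -(ler_pM2l (YMp M)) -{1}eY.
  apply: (@le_trans _ _ ((X ^+ M.+2 - 1) * ((Y ^+ M.+2 - 1) * (X ^+ M.+1 - 1)))).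
    rewrite expr2 -mulrA ler_wpM2r // ?mulr_ge0 ?(ltW (YMp _)) ?(ltW (XMp _)) //.
    by rewrite lerD2r lerXn2r // nnegrE.
  rewrite [leRHS]mulrC expr2 -mulrA ler_wpM2l ?(ltW (XMp _)) //.
  by apply: leM_exprB1 => //; exact: ltW.
(* Substituting [X^(M+1) = 2 k / (1 + k)] shows that the goal is a positive multiple of [bound]. *)
rewrite -subr_ge0; have -> : X * (1 + k ^+ 2) - (k + k ^+ 2) =
  (1 + k) ^+ 2 / 2 * (X * (X ^+ M.+1 - 1) ^+ 2 - X * (X ^+ M - 1)).
  by rewrite [X * (X ^+ M - 1)]mulrBr -exprS XM'; field; rewrite k1n.
rewrite mulr_ge0 ?divr_ge0 ?exprn_ge0 ?(ltW k10) //.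
by rewrite subr_ge0 ler_wpM2l.
Qed.

(** * Choice of parameters and conclusion *)

Theorem theorem7p1 (L : nat) (hL : (2 <= L)%N)
  (V E : finType) (ends : E -> V * V)
  (hloop : loopless ends) (hsp : series_parallel ends)
  (hflow : maxmaxflow_le ends L)
  (C : numClosedFieldType) (rs : C)
  (hrs : if L == 2%N then rs = 1
         else 0 < rs < 1 /\ (1 + rs) ^+ L = 2 * (1 + rs ^+ 2) ^+ L.-1)
  (q : C)
  (hq : if L == 2%N then 1 / rs < `|q - 1| else 1 / rs <= `|q - 1|)
  (v : E -> C)
  (hv : forall e : E,
      let rho := 1 / `|q - 1| in
      let X := (L.-1).-root (2 / (1 + rho)) in
      (v e \is Num.real /\ -1 <= v e <= 0) \/
      (q + v e != 0 /\
       (if L == 2%N then `|v e / (q + v e)| < rho * ((X - 1) / (1 - rho * X))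
        else `|v e / (q + v e)| <= rho * ((X - 1) / (1 - rho * X))))) :
  Zpoly ends q v != 0.
Proof.
case: L hL hflow hrs hq hv => [//|M] /= M0 hflow hrs hq hv.
rewrite eqSS in hrs hq hv; rewrite ltnS in M0.
set k := `|q - 1| in hq hv; set X := M.-root (2 / (1 + 1 / k)) in hv.
have k1 : 1 < k.
  move: hrs hq; case: eqP => _; first by move=> ->; rewrite divr1.
  by case=> /andP[s0 s1] _; apply: lt_le_trans; rewrite div1r invf_gt1.
have k0 := lt_trans ltr01 k1; have kn0 := lt0r_neq0 k0.
have k1n : 1 + k != 0 by rewrite gt_eqF // addr_gt0.
have e2 : 2 / (1 + 1 / k) = 2 * k / (1 + k).
  by field; rewrite kn0 k1n.
have XM : X ^+ M * (1 + k) = 2 * k by rewrite rootCK // e2 divfK.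
have X1 : 1 <= X.
  rewrite rootC_ge1 // e2 ler_pdivlMr ?addr_gt0 // mul1r mulr_natl mulr2n lerD2r.
  exact: ltW.
have XK : k + k ^+ 2 <= X * (1 + k ^+ 2).
  move: hrs hq; have [M1 _ _|M1 [s01 hs] sk] := eqVneq M 1%N.
    (* Here [X = 2 k / (1 + k)] is explicit, and the condition reduces to [k (k - 1)^2 >= 0]. *)
    move: XM; rewrite M1 expr1 => Xk; rewrite -(ler_pM2r (addr_gt0 ltr01 k0)) mulrAC Xk.
    rewrite -subr_ge0.
    have -> : 2 * k * (1 + k ^+ 2) - (k + k ^+ 2) * (1 + k) = k * (k - 1) ^+ 2 by ring.
    by rewrite mulr_ge0 ?exprn_ge0 ?subr_ge0 ?(ltW k0) ?(ltW k1).
  apply: series_threshold s01 hs sk (le_trans ler01 X1) XM.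
  by rewrite ltn_neqAle eq_sym M1.
have q0 := q_neq0 k1.
have Av e : admissible q X M 1 (v e).
  case: (hv e) => [[_ v01]|[qv hve]]; first exact: admissible_real.
  apply: admissible_transmissivity => //.
  by case: eqP hve => // _ /ltW.
apply: (@Zpoly_series_parallel_neq0 _ _ M (admissible q X M) _ _ _ _ _ _ _ _ _
  hsp (fun=> 1%N)) => //.
- exact: admissible0.
- move=> c w A; have [_ ?] := admissible_bound k1 X1 XM A.
  by case: A => /andP[].
- move=> c1 c2 w1 w2; exact: parallel_neq0.
- move=> c1 c2 w1 w2; exact: admissible_parallel.
- move=> c1 c2 w1 w2; exact: admissible_series.
- exact: maxmaxflow_flow_le.
Qed.
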